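(* In $\mathbf{Nil}$ space, the isosceles property of a translation triangle is not equivalent to two angles of the triangle being equal. That is, the assertion ''for every translation triangle, at least two of its sides have equal translation length if and only if at least two of its interior angles are equal'' is false.
   Context: $\mathbf{Nil}$ is $\mathbb{R}^3$ with the Heisenberg group structure: for $P=(p,q,r)$ the translation by $P$ is the map $\mathbf{T}_P:(a,b,c)\mapsto(p+a,\;q+b,\;r+pb+c)$, which carries the origin $O=(0,0,0)$ to $P$. The translation-invariant Riemannian metric is $ds^2=dx^2+dy^2+(dz-x\,dy)^2$, and the translations are isometries of it. A translation curve starting at $O$ with initial vector $(u,v,w)$ is $x(t)=ut,\ y(t)=vt,\ z(t)=\tfrac12uvt^2+wt$. Translation curves starting at another point $P$ are the images of these under $\mathbf{T}_P$. The translation distance $d^t(P_1,P_2)$ is the arc length of the translation curve from $P_1$ to $P_2$. Explicitly, $d^t(O,(x,y,z))=\sqrt{x^2+y^2+(z-\tfrac12xy)^2}$ and $d^t(P_1,P_2)=d^t(O,\mathbf{T}_{P_1}^{-1}(P_2))$. A translation triangle $A_1A_2A_3$ is given by three points not all lying on one translation curve; its sides are the translation curve segments joining pairs of vertices, and the length of the side joining $A_i,A_j$ is $d^t(A_i,A_j)$. It is isosceles if at least two sides have equal length. The interior angle at a vertex $A_i$ is the angle, measured in the Riemannian metric at $A_i$, between the tangent vectors at $A_i$ of the two translation curves starting at $A_i$ and going to the other two vertices. *)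

(* Defs.v *)
From Stdlib Require Import Reals Lra.
From Coquelicot Require Import Coquelicot.
Local Open Scope R_scope.

Definition point : Type := (R * R * R)%type.
Definition vec : Type := (R * R * R)%type.

Definition cx (P : R * R * R) : R := fst (fst P).
Definition cy (P : R * R * R) : R := snd (fst P).
Definition cz (P : R * R * R) : R := snd P.

Definition translate (P A : point) : point :=
  (cx P + cx A, cy P + cy A, cz P + cx P * cy A + cz A).

Definition translate_inv (P A : point) : point :=
  (cx A - cx P, cy A - cy P, cz A - cz P - cx P * (cy A - cy P)).

Lemma translateK (P A : point) : translate_inv P (translate P A) = A.
Proof.
destruct P as [[p q] r], A as [[a b] c].
unfold translate, translate_inv, cx, cy, cz; simpl.
f_equal; [f_equal|]; ring.
Qed.

Lemma translate_invK (P A : point) : translate P (translate_inv P A) = A.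
Proof.
destruct P as [[p q] r], A as [[a b] c].
unfold translate, translate_inv, cx, cy, cz; simpl.
f_equal; [f_equal|]; ring.
Qed.

(* Polarization of ds^2 = dx^2 + dy^2 + (dz - x dy)^2 at the point P. *)
Definition metric (P : point) (V W : vec) : R :=
  cx V * cx W + cy V * cy W
  + (cz V - cx P * cy V) * (cz W - cx P * cy W).

Definition metric_norm (P : point) (V : vec) : R := sqrt (metric P V V).

Definition riem_angle (P : point) (V W : vec) : R :=
  acos (metric P V W / (metric_norm P V * metric_norm P W)).

Definition velocity (c : R -> point) (t : R) : vec :=
  (Derive (fun s => cx (c s)) t,
   Derive (fun s => cy (c s)) t,
   Derive (fun s => cz (c s)) t).

Definition arc_length (c : R -> point) (a b : R) : R :=
  RInt (fun t => metric_norm (c t) (velocity c t)) a b.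

Definition translation_curve_O (V : vec) (t : R) : point :=
  (cx V * t, cy V * t, / 2 * cx V * cy V * t ^ 2 + cz V * t).

(* V is the initial vector of the curve at the origin; the initial velocity of
   the translated curve is its image under the differential of the
   translation. *)
Definition translation_curve (P : point) (V : vec) (t : R) : point :=
  translate P (translation_curve_O V t).

Definition initial_vector (P Q : point) : vec :=
  let A := translate_inv P Q in (cx A, cy A, cz A - / 2 * cx A * cy A).

(* From P at t = 0 to Q at t = 1; V = initial_vector P Q is the only vector with
   translation_curve P V 1 = Q, see translation_curve_1_iff. *)
Definition curve_between (P Q : point) : R -> point :=
  translation_curve P (initial_vector P Q).

Lemma curve_between_0 (P Q : point) : curve_between P Q 0 = P.
Proof.
destruct P as [[p q] r], Q as [[a b] c].
unfold curve_between, translation_curve, translation_curve_O, translate,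
  initial_vector, translate_inv, cx, cy, cz; simpl.
f_equal; [f_equal|]; ring.
Qed.

Lemma translation_curve_1_iff (P Q : point) (V : vec) :
  translation_curve P V 1 = Q <-> V = initial_vector P Q.
Proof.
destruct P as [[p q] r], Q as [[a b] c], V as [[u v] w].
unfold translation_curve, translation_curve_O, translate,
  initial_vector, translate_inv, cx, cy, cz; simpl.
split; intros E; injection E; intros; subst;
  (f_equal; [f_equal|]; field).
Qed.

Lemma curve_between_1 (P Q : point) : curve_between P Q 1 = Q.
Proof. now apply translation_curve_1_iff. Qed.

Definition translation_distance (P Q : point) : R :=
  arc_length (curve_between P Q) 0 1.

Lemma velocity_translation_curve (P : point) (V : vec) (t : R) :
  velocity (translation_curve P V) t =
  (cx V, cy V, cz V + (cx P + cx V * t) * cy V).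
Proof.
destruct P as [[p q] r], V as [[u v] w].
unfold velocity, translation_curve, translation_curve_O, translate, cx, cy, cz;
  simpl.
f_equal; [f_equal|]; apply is_derive_unique; auto_derive; trivial; field.
Qed.

Lemma translation_distanceE (P Q : point) :
  translation_distance P Q =
  let A := translate_inv P Q in
  sqrt (cx A ^ 2 + cy A ^ 2 + (cz A - / 2 * cx A * cy A) ^ 2).
Proof.
unfold translation_distance, arc_length.
rewrite (RInt_ext _ (fun _ => let A := translate_inv P Q in
  sqrt (cx A ^ 2 + cy A ^ 2 + (cz A - / 2 * cx A * cy A) ^ 2))).
  rewrite RInt_const; unfold scal; simpl; unfold mult; simpl; ring.
intros t _; unfold curve_between.
rewrite velocity_translation_curve; unfold metric_norm; f_equal.
destruct P as [[p q] r], Q as [[a b] c].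
unfold metric, translation_curve, translation_curve_O, translate,
  initial_vector, translate_inv, cx, cy, cz; simpl; ring.
Qed.

(* The curve is complete: the parameters range over all of R, so the starting
   point P need not come first among the three points. *)
Definition on_one_translation_curve (A1 A2 A3 : point) : Prop :=
  exists (P : point) (V : vec) (t1 t2 t3 : R),
    translation_curve P V t1 = A1 /\
    translation_curve P V t2 = A2 /\
    translation_curve P V t3 = A3.

Definition translation_triangle (A1 A2 A3 : point) : Prop :=
  ~ on_one_translation_curve A1 A2 A3.

Definition interior_angle (A B C : point) : R :=
  riem_angle A (velocity (curve_between A B) 0)
               (velocity (curve_between A C) 0).

Definition two_equal (a b c : R) : Prop := a = b \/ b = c \/ a = c.

Definition isosceles (A1 A2 A3 : point) : Prop :=
  two_equal (translation_distance A2 A3)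
            (translation_distance A1 A3)
            (translation_distance A1 A2).

Definition two_equal_angles (A1 A2 A3 : point) : Prop :=
  two_equal (interior_angle A1 A2 A3)
            (interior_angle A2 A1 A3)
            (interior_angle A3 A1 A2).

(* Main.v *)
Require Import Defs.
From Stdlib Require Import Reals Lra.
From Coquelicot Require Import Coquelicot.
Local Open Scope R_scope.

(** In the left-invariant orthonormal frame, the translation curve from [P] to
    [Q] has constant coordinates [initial_vector P Q], so lengths and angles are
    the Euclidean ones of these vectors.  If the curves from [A1] have initial
    vectors [X] and [Y], the one from [A2] to [A3] has initial vector
    [Y - X] minus half of the Lie bracket of [X] and [Y], a vertical vector.
    With [|X| = |Y|], the correction tilts this vector up or down; when [X]
    and [Y] have the same nonzero vertical component and independent horizontal
    parts, the tilt opens one base angle and closes the other.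

    For [X = (1, 0, 1)] and [Y = (0, 1, 1)] the third vector is
    [(-1, 1, -1/2)].  The sides have lengths [sqrt 2], [sqrt 2], [3/2], so the
    triangle is isosceles, but the cosines of its angles are [1/2],
    [1 / sqrt 2] and [1 / (3 sqrt 2)], which are pairwise distinct: isosceles does
    not imply two equal angles. *)

Definition dot (V W : vec) : R :=
  cx V * cx W + cy V * cy W + cz V * cz W.

(** The differential of the translation by [P] carries the frame at the origin
    to an orthonormal frame at [P], so the base point disappears from the
    metric. *)
Lemma metric_initial_velocity (P Q S : point) :
  metric P (velocity (curve_between P Q) 0) (velocity (curve_between P S) 0)
  = dot (initial_vector P Q) (initial_vector P S).
Proof.
unfold curve_between; rewrite !velocity_translation_curve.
unfold metric, dot, cx, cy, cz; simpl; ring.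
Qed.

Lemma interior_angleE (P Q S : point) :
  interior_angle P Q S =
  acos (dot (initial_vector P Q) (initial_vector P S)
        / (sqrt (dot (initial_vector P Q) (initial_vector P Q))
           * sqrt (dot (initial_vector P S) (initial_vector P S)))).
Proof.
unfold interior_angle, riem_angle, metric_norm.
now rewrite !metric_initial_velocity.
Qed.

(** Translation curves project to straight lines of the [(x, y)]-plane, so three
    points with non-collinear projections form a triangle. *)
Lemma translation_triangle_of_projection (A1 A2 A3 : point) :
  (cx A2 - cx A1) * (cy A3 - cy A1) <> (cx A3 - cx A1) * (cy A2 - cy A1) ->
  translation_triangle A1 A2 A3.
Proof.
intros noncollinear (P & V & t1 & t2 & t3 & <- & <- & <-).
apply noncollinear.
unfold translation_curve, translation_curve_O, translate, cx, cy; simpl; ring.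
Qed.

Definition apex : point := (0, 0, 0).
Definition base1 : point := (1, 0, 1).
Definition base2 : point := (0, 1, 1).

Lemma isosceles_example : isosceles apex base1 base2.
Proof.
right; left.
rewrite !translation_distanceE.
unfold translate_inv, apex, base1, base2, cx, cy, cz; simpl.
f_equal; ring.
Qed.

Lemma cos_angle_apex : cos (interior_angle apex base1 base2) = 1 / 2.
Proof.
rewrite interior_angleE.
unfold dot, initial_vector, translate_inv, apex, base1, base2, cx, cy, cz; simpl.
match goal with |- context [acos (?n / (sqrt ?a * sqrt ?b))] =>
  replace n with 1 by field; replace a with 2 by field;
  replace b with 2 by field end.
rewrite sqrt_sqrt by lra.
apply cos_acos; lra.
Qed.

Lemma sqrt_9_4 : sqrt (9 / 4) = 3 / 2.
Proof.
replace (9 / 4) with (3 / 2 * (3 / 2)) by field.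
apply sqrt_square; lra.
Qed.

Lemma one_lt_sqrt2 : 1 < sqrt 2.
Proof. rewrite <- sqrt_1; apply sqrt_lt_1; lra. Qed.

Lemma cos_angle_base1 : cos (interior_angle base1 apex base2) = 1 / sqrt 2.
Proof.
rewrite interior_angleE.
unfold dot, initial_vector, translate_inv, apex, base1, base2, cx, cy, cz; simpl.
match goal with |- context [acos (?n / (sqrt ?a * sqrt ?b))] =>
  replace n with (3 / 2) by field; replace a with 2 by field;
  replace b with (9 / 4) by field end.
rewrite sqrt_9_4.
pose proof one_lt_sqrt2 as s_gt1.
replace (3 / 2 / (sqrt 2 * (3 / 2))) with (1 / sqrt 2) by (field; lra).
assert (0 < 1 / sqrt 2) by (apply Rdiv_lt_0_compat; lra).
assert (1 / sqrt 2 < 1) by (apply Rlt_div_l; lra).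
apply cos_acos; lra.
Qed.

Lemma cos_angle_base2 : cos (interior_angle base2 apex base1) = 1 / 3 / sqrt 2.
Proof.
rewrite interior_angleE.
unfold dot, initial_vector, translate_inv, apex, base1, base2, cx, cy, cz; simpl.
match goal with |- context [acos (?n / (sqrt ?a * sqrt ?b))] =>
  replace n with (1 / 2) by field; replace a with 2 by field;
  replace b with (9 / 4) by field end.
rewrite sqrt_9_4.
pose proof one_lt_sqrt2 as s_gt1.
replace (1 / 2 / (sqrt 2 * (3 / 2))) with (1 / 3 / sqrt 2) by (field; lra).
assert (0 < 1 / 3 / sqrt 2) by (apply Rdiv_lt_0_compat; lra).
assert (1 / 3 / sqrt 2 < 1) by (apply Rlt_div_l; lra).
apply cos_acos; lra.
Qed.

Lemma not_two_equal_angles_example : ~ two_equal_angles apex base1 base2.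
Proof.
pose proof one_lt_sqrt2 as s_gt1.
assert (s_sq : sqrt 2 * sqrt 2 = 2) by (apply sqrt_sqrt; lra).
assert (s_inv : 1 / sqrt 2 = sqrt 2 / 2).
{ rewrite <- s_sq at 3; field; lra. }
assert (s_inv3 : 1 / 3 / sqrt 2 = sqrt 2 / 6).
{ replace (1 / 3 / sqrt 2) with (1 / sqrt 2 / 3) by (field; lra).
  rewrite s_inv; field. }
intros [E | [E | E]]; apply (f_equal cos) in E;
  rewrite ?cos_angle_apex, ?cos_angle_base1, ?cos_angle_base2, ?s_inv3, ?s_inv
    in E.
- lra.
- lra.
- assert (sqrt 2 = 3) as s3 by lra; rewrite s3 in s_sq; lra.
Qed.

Theorem proposition3p4 :
  ~ (forall A1 A2 A3 : point,
       translation_triangle A1 A2 A3 ->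
       (isosceles A1 A2 A3 <-> two_equal_angles A1 A2 A3)).
Proof.
intros equivalence.
apply not_two_equal_angles_example.
apply equivalence.
- apply translation_triangle_of_projection.
  unfold apex, base1, base2, cx, cy; simpl; lra.
- exact isosceles_example.
Qed.
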